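(* Let $\mu$ be a probability measure on $[0,\infty)$ with mean $1$ such that $\Lambda_\mu$ is finite on a neighborhood of $0$. Let $P$ be a probability measure and $\nu$ a $\sigma$-finite positive measure with $dP=p\,d\nu$. Define $\psi:[0,\infty)\to[0,1]$ by $\psi(y)=P(p\le y)$, and assume $$\mathrm{range}(G_\mu)\subset\mathrm{range}(\psi)\cup\{1\}.$$ Define $H_\mu:[0,1]\to[0,\infty]$ by $H_\mu(\rho)=\sup\{r\in[0,\infty):G_\mu(r)\ge\rho\}$ and $\phi:[0,\infty)\to[0,\infty)$ by $\phi(y)=H_\mu(\psi(y))1_{\psi(y)>0}$. Then $Q(dx)=\phi(p(x))P(dx)$ is a probability measure, $dQ/dP$ has distribution $\mu$ under $P$, and $Q\in\mathcal{U}^\mu(P)$.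
   Context: For a probability measure $\mu$ on $[0,\infty)$ with mean $1$, $G_\mu(r)=\mu([r,\infty))$ for $r\ge0$ and $\Lambda_\mu(\lambda)=\log\big((\lambda+1)\int_0^\infty G_\mu(z)z^\lambda\,dz\big)$ for $\lambda\ge0$. With $\Lambda_Q^f(\lambda)=\log E_Q[e^{\lambda f}]$, and $\Lambda_\mu$ finite near $0$, $\mathcal{U}^\mu(P)=\{Q \text{ probability measure}: Q\ll P,\ \Lambda_Q^{\log(dQ/dP)}(\lambda)\le\Lambda_\mu(\lambda)\ \text{for all }\lambda>0\}$. *)

(* Defs.v *)
From HB Require Import structures.
From mathcomp Require Import all_boot all_order all_algebra.
From mathcomp Require Import all_classical all_reals all_analysis.
Set Implicit Arguments. Unset Strict Implicit. Unset Printing Implicit Defensive.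
Import Order.TTheory GRing.Theory Num.Theory.
Import numFieldNormedType.Exports.
Local Open Scope classical_set_scope.
Local Open Scope ring_scope.

Definition G_mu (R : realType) (mu : probability R R) (r : R) : R :=
  fine (mu `[r, +oo[%classic).

(* Lambda_mu(lambda) = log((lambda+1) * int_0^oo G_mu(z) z^lambda dz),
   with the extended logarithm lne (log 0 = -oo, log +oo = +oo). *)
Definition Lambda_mu (R : realType) (mu : probability R R) (l : R) : \bar R :=
  lne ((l + 1)%:E *
       \int[lebesgue_measure]_(z in `[0%R, +oo[%classic) (G_mu mu z * z `^ l)%:E)%E.

Definition Lambda_Q (d : measure_display) (T : measurableType d) (R : realType)
  (Q : {measure set T -> \bar R}) (f : T -> \bar R) (l : R) : \bar R :=
  lne (\int[Q]_x expeR (l%:E * f x))%E.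

Definition is_density (d : measure_display) (T : measurableType d) (R : realType)
  (Q P : {measure set T -> \bar R}) (g : T -> R) : Prop :=
  measurable_fun setT g /\ (forall x, 0 <= g x) /\
  (forall A, measurable A -> Q A = (\int[P]_(x in A) (g x)%:E)%E).

Definition in_U (d : measure_display) (T : measurableType d) (R : realType)
  (mu : probability R R) (P Q : probability T R) : Prop :=
  Q `<< P /\
  exists g : T -> R, is_density Q P g /\
    forall l : R, 0 < l ->
      (Lambda_Q Q (fun x => lne (g x)%:E) l <= Lambda_mu mu l)%E.

Definition psi_P (d : measure_display) (T : measurableType d) (R : realType)
  (P : probability T R) (p : T -> R) (y : R) : R :=
  fine (P [set x | p x <= y]).

Definition H_mu (R : realType) (mu : probability R R) (rho : R) : \bar R :=
  ereal_sup [set r%:E | r in [set r : R | 0 <= r /\ rho <= G_mu mu r]].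

Definition phi_fun (d : measure_display) (T : measurableType d) (R : realType)
  (mu : probability R R) (P : probability T R) (p : T -> R) (y : R) : R :=
  if 0 < psi_P P p y then fine (H_mu mu (psi_P P p y)) else 0.

(* Main.v *)
Require Import Defs.
From HB Require Import structures.
From mathcomp Require Import all_boot all_order all_algebra.
From mathcomp Require Import all_classical all_reals all_analysis.
From mathcomp Require Import measurable_realfun.
Import Order.TTheory GRing.Theory Num.Theory.
Import numFieldNormedType.Exports.
Local Open Scope classical_set_scope.
Local Open Scope ring_scope.
Set Implicit Arguments.
Unset Strict Implicit.
Unset Printing Implicit Defensive.

(* G := G_mu is left-continuous and vanishes at infinity, so H_mu is its
   generalised inverse: r <= H_mu rho iff rho <= G r, for 0 < rho <= 1 and
   0 <= r.  Hence, for r > 0, phi (p x) >= r iff 0 < psi (p x) <= G r.  As psi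
   is the distribution function of p, P (psi (p) <= c) <= c for all c >= 0, with
   equality when c is a value of psi or c = 1; the range hypothesis then gives
   P (phi (p) >= r) = G r, so phi (p) has law mu under P.  Finally, the
   l-th moment of phi (p) under Q is the (l+1)-th moment of mu, which is
   (l+1) \int G(z) z^l dz by Fubini: the inequality defining U^mu is
   an equality. *)

(** * The distribution function of [p] and the law of [psi (p)] under [P] *)

Section distribution_function.
Context (R : realType) (d : measure_display) (T : measurableType d)
  (P : probability T R) (p : T -> R).
Hypothesis mp : measurable_fun setT p.

Lemma measurable_sublevel (y : R) : measurable [set x | p x <= y].
Proof.
rewrite (_ : [set x | _] = setT `&` p @^-1` `]-oo, y]%classic).
  exact: mp.
by rewrite setTI; apply/seteqP; split => x /=; rewrite in_itv.
Qed.

Lemma psi_PE (y : R) : (psi_P P p y)%:E = P [set x | p x <= y].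
Proof. by rewrite /psi_P fineK// fin_num_measure//; exact: measurable_sublevel. Qed.

Lemma psi_P_le1 (y : R) : psi_P P p y <= 1.
Proof. by rewrite -lee_fin psi_PE probability_le1//; exact: measurable_sublevel. Qed.

Lemma psi_P_nondecreasing : {homo psi_P P p : a b / a <= b}.
Proof.
move=> a b ab; rewrite -lee_fin !psi_PE le_measure ?inE//;
  try exact: measurable_sublevel.
by move=> x /= /le_trans; apply.
Qed.

Lemma measurable_psi_P_comp : measurable_fun setT (psi_P P p \o p).
Proof.
apply: measurableT_comp => //.
by apply: nondecreasing_measurable => // a b; exact: psi_P_nondecreasing.
Qed.

Lemma measurable_psi_P_sublevel (c : R) :
  measurable [set x | psi_P P p (p x) <= c].
Proof.
rewrite (_ : [set x | _] = setT `&` (psi_P P p \o p) @^-1` `]-oo, c]%classic).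
  exact: measurable_psi_P_comp.
by rewrite setTI; apply/seteqP; split => x /=; rewrite in_itv.
Qed.

(** Continuity of [P] from below carries the bound to the limit; this serves the half-lines of
    levels that have no largest element. *)
Lemma measure_bigcup_nondecreasing_le (F : (set T)^nat) (c : \bar R) :
  (forall n, measurable (F n)) ->
  {homo F : n m / (n <= m)%N >-> (n <= m)%O} ->
  (forall n, P (F n) <= c)%E -> (P (\bigcup_n F n) <= c)%E.
Proof.
move=> mF ndF Fc.
have cF : (P \o F) x @[x --> \oo] --> P (\bigcup_n F n).
  by apply: nondecreasing_cvg_mu => //; exact: bigcup_measurable.
rewrite -(cvg_lim _ cF)//; apply: lime_le; first exact: cvgP cF.
by apply: nearW => n; exact: Fc.
Qed.

(* The set of levels y with psi y <= c is a left half-line; it is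
   exhausted by countably many half-lines ]-oo, y_n] with psi y_n <= c. *)
Lemma prob_psi_P_le (c : R) : 0 <= c ->
  (P [set x | (psi_P P p (p x) <= c)%R] <= c%:E)%E.
Proof.
move=> c0; pose D := [set y | psi_P P p y <= c].
have Ddown a b : D b -> a <= b -> D a.
  by move=> Db ab; exact: le_trans (psi_P_nondecreasing ab) Db.
have [D0|/set0P[y0 Dy0]] := eqVneq D set0.
  rewrite (_ : [set x | _] = set0) ?measure0 ?lee_fin//.
  by rewrite -subset0 => x Dx; have : D (p x) := Dx; rewrite D0.
(* If [D] has no upper bound it is the whole line, and the levels [n%:R] exhaust it. *)
have [bD|nbD] := pselect (has_ubound D); last first.
  rewrite (_ : [set x | _] = \bigcup_n [set x | p x <= n%:R]).
    apply: measure_bigcup_nondecreasing_le => [n|m n mn|n].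
    - exact: measurable_sublevel.
    - by apply/subsetPset => x /= /le_trans; apply; rewrite ler_nat.
    - rewrite -psi_PE lee_fin; apply: contrapT => nDn; apply: nbD.
      exists n%:R => y Dy; rewrite leNgt; apply/negP => /ltW ny; apply: nDn.
      exact: Ddown Dy ny.
  apply/seteqP; split => x /=.
    move=> _; exists ((Num.truncn (p x)).+1) => //=.
    by rewrite ltW// truncnS_gt.
  move=> _; apply: contrapT => nDx; apply: nbD.
  exists (p x) => y Dy; rewrite leNgt; apply/negP => /ltW xy; apply: nDx.
  exact: Ddown Dy xy.
have sD : has_sup D by split => //; exists y0.
(* When [sup D] lies in [D], this single level suffices; otherwise [D] is an open half-line,
   exhausted by the levels [sup D - 1/(n+1)]. *)
have [Ds|nDs] := pselect (D (sup D)).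
  rewrite (_ : [set x | _] = [set x | p x <= sup D]) -?psi_PE//.
  apply/seteqP; split => x /= Dx; last exact: Ddown Ds Dx.
  by apply: ub_le_sup.
rewrite (_ : [set x | _] = \bigcup_n [set x | p x <= sup D - n.+1%:R^-1]).
  apply: measure_bigcup_nondecreasing_le => [n|m n mn|n].
  - exact: measurable_sublevel.
  - apply/subsetPset => x /= /le_trans; apply.
    by rewrite lerD2l lerN2 lef_pV2 ?posrE// ler_nat.
  - have [|y Dy yn] := @sup_adherent _ D n.+1%:R^-1 _ sD => //.
    by rewrite -psi_PE lee_fin; exact: Ddown Dy (ltW yn).
apply/seteqP; split => x /=.
  move=> Dx; have xs : p x < sup D.
    rewrite lt_neqAle (ub_le_sup bD)// andbT; apply/eqP => xs.
    by apply: nDs; rewrite -xs.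
  have [n nx] := ltr_add_invr xs.
  by exists n => //=; rewrite lerBrDr ltW.
move=> [n _ /= xn]; apply: contrapT => nDx.
have [|y Dy yn] := @sup_adherent _ D n.+1%:R^-1 _ sD => //.
by apply: nDx; exact: Ddown Dy (le_trans xn (ltW yn)).
Qed.

End distribution_function.

(** * Left-continuity of the tail function and its generalised inverse *)

Section tail.
Context (R : realType) (mu : probability R R).
Hypothesis mu_ge0 : mu `[0%R, +oo[%classic = 1%E.

Lemma G_muE (r : R) : (G_mu mu r)%:E = mu `[r, +oo[%classic.
Proof. by rewrite /G_mu fineK// fin_num_measure. Qed.

Lemma G_mu_ge0 (r : R) : 0 <= G_mu mu r.
Proof. by rewrite -lee_fin G_muE. Qed.

Lemma G_mu_nonincreasing : {homo G_mu mu : a b / a <= b >-> b <= a}.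
Proof.
move=> a b ab; rewrite -lee_fin !G_muE le_measure ?inE//.
by apply: subset_itvr; rewrite bnd_simp.
Qed.

Lemma G_mu_le0 (r : R) : r <= 0 -> G_mu mu r = 1.
Proof.
move=> r0; apply/eqP; rewrite eq_le -!lee_fin G_muE probability_le1//= -mu_ge0.
by rewrite le_measure ?inE//; apply: subset_itvr; rewrite bnd_simp.
Qed.

(** The half-lines [[n, oo)] decrease to the empty set. This bounds the set whose supremum defines
    [H_mu], so that [fine] loses nothing there. *)
Lemma G_mu_eventually_lt (rho : R) : 0 < rho -> exists r, G_mu mu r < rho.
Proof.
move=> rho0.
have cG : (mu \o (fun n => `[n%:R, +oo[%classic)) x @[x --> \oo] -->
    mu (\bigcap_n `[n%:R : R, +oo[%classic).
  apply: nonincreasing_cvg_mu => //=.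
  - by rewrite -ge0_fin_numE// fin_num_measure.
  - exact: bigcap_measurable.
  - by move=> m n mn; apply/subsetPset/subset_itvr; rewrite bnd_simp ler_nat.
have I0 : \bigcap_n `[n%:R : R, +oo[%classic = set0.
  rewrite -subset0 => x /(_ ((Num.truncn x).+1) I)/=; rewrite in_itv/= andbT.
  by apply/negP; rewrite -ltNge truncnS_gt.
rewrite I0 measure0 in cG.
apply: contrapT => nG.
have : (rho%:E <= limn (mu \o (fun n => `[n%:R, +oo[%classic)))%E.
  apply: lime_ge; first exact: cvgP cG.
  apply: nearW => n /=; rewrite -G_muE lee_fin leNgt; apply/negP => Gn.
  by apply: nG; exists n%:R.
by rewrite (cvg_lim _ cG)// lee_fin leNgt rho0.
Qed.

(** Continuity from above, since [[s, oo)] is the intersection of the half-lines that start to the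
    left of [s]. *)
Lemma G_mu_left_limit (rho s : R) : (forall r, r < s -> rho <= G_mu mu r) ->
  rho <= G_mu mu s.
Proof.
move=> Gr; rewrite -lee_fin G_muE itvcyEbigcap.
have cG : (mu \o (fun n => `]s - n.+1%:R^-1, +oo[%classic)) x @[x --> \oo] -->
    mu (\bigcap_n `]s - n.+1%:R^-1, +oo[%classic).
  apply: nonincreasing_cvg_mu => //=.
  - by rewrite -ge0_fin_numE// fin_num_measure.
  - exact: bigcap_measurable.
  - move=> m n mn; apply/subsetPset/subset_itvr; rewrite bnd_simp.
    by rewrite lerD2l lerN2 lef_pV2 ?posrE// ler_nat.
rewrite -(cvg_lim _ cG)//; apply: lime_ge; first exact: cvgP cG.
(* The half-line from [s - 1/(n+1)] is open; a closed one fits inside it when it starts at a point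
   strictly between [s - 1/(n+1)] and [s]. *)
apply: nearW => n /=; pose t := s - n.+2%:R^-1.
have ts : t < s by rewrite ltrBlDr ltrDl invr_gt0.
apply: (@le_trans _ _ (G_mu mu t)%:E); first by rewrite lee_fin Gr.
rewrite G_muE le_measure ?inE//; apply: subset_itvr; rewrite bnd_simp.
by rewrite ltrD2l ltrN2 ltf_pV2 ?posrE// ltr_nat.
Qed.

(** [rho <= 1] puts 0 in the set [S] and [0 < rho] bounds it, so its supremum is real; by
    left-continuity [G_mu] is still at least [rho] there, and monotonicity gives the rest. *)
Lemma le_H_mu (rho r : R) : 0 < rho <= 1 -> 0 <= r ->
  (r <= fine (H_mu mu rho)) = (rho <= G_mu mu r).
Proof.
move=> /andP[rho0 rho1] r0.
pose S := [set r : R | 0 <= r /\ rho <= G_mu mu r].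
have S0 : S 0 by split => //; rewrite G_mu_le0.
have [b Gb] := G_mu_eventually_lt rho0.
have ubS : ubound S b.
  move=> x [_ Gx]; rewrite leNgt; apply/negP => /ltW bx.
  by have := lt_le_trans Gb (le_trans Gx (G_mu_nonincreasing bx)); rewrite ltxx.
have sS : has_sup S by split; [exists 0|exists b].
have -> : fine (H_mu mu rho) = sup S.
  by rewrite /H_mu -/S ereal_sup_EFin//; [exists b|exists 0].
apply/idP/idP => [rs|Gr]; last first.
  by apply: ub_le_sup; [exists b|split].
apply: le_trans (G_mu_nonincreasing rs).
apply: G_mu_left_limit => t ts.
have [x [_ Gx] tx] := @sup_adherent _ S (sup S - t) ltac:(by rewrite subr_gt0) sS.
rewrite opprB addrCA subrr addr0 in tx.
exact: le_trans Gx (G_mu_nonincreasing (ltW tx)).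
Qed.

End tail.

(** * The law of [phi (p)] under [P] *)

Section phi.
Context (R : realType) (mu : probability R R) (d : measure_display)
  (T : measurableType d) (P : probability T R) (p : T -> R).
Hypothesis mu_ge0 : mu `[0%R, +oo[%classic = 1%E.
Hypothesis mp : measurable_fun setT p.

Let g x := phi_fun mu P p (p x).

Lemma phi_fun_ge0 (y : R) : 0 <= phi_fun mu P p y.
Proof.
rewrite /phi_fun; case: ifPn => // y0; apply: fine_ge0.
by apply: ereal_sup_ubound; exists 0 => //; split => //;
  rewrite (G_mu_le0 mu_ge0)// psi_P_le1.
Qed.

Lemma le_phi_fun (r y : R) : 0 < r ->
  (r <= phi_fun mu P p y) = (0 < psi_P P p y <= G_mu mu r).
Proof.
move=> r0; rewrite /phi_fun; case: ifPn => [y0|_]/=; last by rewrite leNgt r0.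
by rewrite le_H_mu ?(ltW r0)// y0 psi_P_le1.
Qed.

(** Removing the level 0 of [psi (p)] accounts for the branch where [phi_fun] is 0 by definition. *)
Lemma phi_fun_superlevel (r : R) : 0 < r ->
  g @^-1` `[r, +oo[%classic =
  [set x | psi_P P p (p x) <= G_mu mu r] `\` [set x | psi_P P p (p x) <= 0].
Proof.
move=> r0; apply/seteqP; split => x /=; rewrite in_itv/= andbT le_phi_fun// ltNge.
  by move=> /andP[/negP].
by move=> [-> /negP ->].
Qed.

Lemma phi_fun_superlevel_le0 (r : R) : r <= 0 -> g @^-1` `[r, +oo[%classic = setT.
Proof.
move=> r0; apply/seteqP; split => x //= _; rewrite in_itv/= andbT.
exact: le_trans r0 (phi_fun_ge0 _).
Qed.

Lemma measurable_phi_fun_comp : measurable_fun setT g.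
Proof.
apply: (measurability (@RGenCInfty.G R)) => [|/= _ [_] [r] -> <-].
  exact: RGenCInfty.measurableE.
rewrite setTI; have [r0|r0] := leP r 0.
  by rewrite phi_fun_superlevel_le0.
by rewrite phi_fun_superlevel//; apply: measurableD; exact: measurable_psi_P_sublevel.
Qed.

Hypothesis range_G : forall r : R, 0 <= r ->
  G_mu mu r = 1 \/ exists y : R, 0 <= y /\ psi_P P p y = G_mu mu r.

(** For [r > 0], [prob_psi_P_le] at level 0 makes the removed set null, and at level [G_mu mu r] it
    gives the upper bound. For the lower bound, if [G_mu mu r = psi y] then [psi (p) <= psi y] holds
    wherever [p <= y], an event of probability [psi y]. *)
Lemma prob_phi_fun_superlevel (r : R) :
  P (g @^-1` `[r, +oo[%classic) = mu `[r, +oo[%classic.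
Proof.
have [r0|r0] := leP r 0.
  by rewrite phi_fun_superlevel_le0// probability_setT -G_muE G_mu_le0.
rewrite phi_fun_superlevel// -G_muE.
have mS c := measurable_psi_P_sublevel P mp c.
have PS0 : P [set x | psi_P P p (p x) <= 0] = 0%E.
  by apply/eqP; rewrite eq_le measure_ge0 andbT prob_psi_P_le.
rewrite measureD//; last by rewrite -ge0_fin_numE// fin_num_measure.
rewrite (@subset_measure0 _ _ _ P _ _ _ _ (@subIsetr _ _ _) PS0)//; last first.
  exact: measurableI.
rewrite sube0; apply/eqP; rewrite eq_le prob_psi_P_le ?G_mu_ge0//=.
have [G1|[y [_ yG]]] := range_G (ltW r0).
  rewrite G1 (_ : [set x | _] = setT) ?probability_setT//.
  by apply/seteqP; split => x //= _; exact: psi_P_le1.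
rewrite -yG psi_PE// le_measure ?inE//; first exact: measurable_sublevel.
by move=> x /= xy; exact: psi_P_nondecreasing.
Qed.

(** The closed half-lines [[r, oo)] are stable under intersection and generate the Borel sets, so
    two finite measures that agree on them coincide. *)
Lemma distribution_phi_fun (B : set R) : measurable B -> P (g @^-1` B) = mu B.
Proof.
move=> mB.
pose gm := HB.pack_for {mfun T >-> R} g
  (isMeasurableFun.Build _ _ _ _ g measurable_phi_fun_comp).
rewrite -[LHS]/(pushforward P gm B).
apply: (measure_unique (@RGenCInfty.G R) (fun n => `[- n%:R, +oo[%classic)) => //=.
- exact: RGenCInfty.measurableE.
- move=> _ _ [r ->] [s ->]; exists (Num.max r s).
  by apply/seteqP; split => x /=; rewrite !in_itv/= !andbT ge_max => /andP.
- by move=> n; eexists.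
- apply/seteqP; split => x //= _; exists (Num.truncn (- x)).+1 => //=.
  by rewrite in_itv/= andbT lerNl ltW// truncnS_gt.
- by move=> _ [r ->]; exact: prob_phi_fun_superlevel.
- by move=> n; rewrite /pushforward/= prob_phi_fun_superlevel -G_muE ltry.
Qed.

End phi.

(** * Change of measure by a density *)

Section density.
Context (R : realType) (d : measure_display) (T : measurableType d).
Local Open Scope ereal_scope.

(** [g] and the Radon-Nikodym derivative have the same integral [Q E] over each measurable [E],
    hence agree [P]-almost everywhere. *)
Lemma ge0_integral_is_density (P Q : probability T R) (g : T -> R)
    (f : T -> \bar R) :
  is_density Q P g -> Q `<< P ->
  measurable_fun setT f -> (forall x, 0 <= f x) ->
  \int[Q]_x f x = \int[P]_x (f x * (g x)%:E).
Proof.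
move=> [mg [g0 QE]] QP mf f0.
rewrite -(Radon_Nikodym_SigmaFinite.change_of_variables QP)//.
have iRN := Radon_Nikodym_SigmaFinite.f_integrable QP.
have mRN := measurable_int _ iRN.
have mgE : measurable_fun setT (EFin \o g) by exact/measurable_EFinP.
apply: ae_eq_integral => //; [exact: emeasurable_funM|exact: emeasurable_funM|].
apply: ae_eqe_mul2l; apply: integral_ae_eq => // E _ mE.
by rewrite -Radon_Nikodym_SigmaFinite.f_integral// QE.
Qed.

Lemma exists_probability_density (P : probability T R) (g : T -> R) :
  measurable_fun setT g -> (forall x, 0 <= g x)%R -> \int[P]_x (g x)%:E = 1 ->
  exists Q : probability T R, is_density Q P g /\ Q `<< P.
Proof.
move=> mg g0 g1.
have mgE : measurable_fun setT (EFin \o g) by exact/measurable_EFinP.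
pose q A := \int[P]_(x in A) (g x)%:E.
have q0 : q set0 = 0 by rewrite /q integral_set0.
have q_ge0 A : 0 <= q A by apply: integral_ge0 => x _; rewrite lee_fin.
have q_add : semi_sigma_additive q.
  by apply: semi_sigma_additive_nng_induced => // x; rewrite lee_fin.
pose Qm := HB.pack_for {measure set T -> \bar R} q
  (isMeasure.Build _ _ _ q q0 q_ge0 q_add).
pose Q := HB.pack_for (probability T R) q Qm
  (Measure_isProbability.Build _ _ _ Qm g1).
exists Q; split; first by split.
apply/null_content_dominatesP => A mA PA0.
by rewrite /= /q null_set_integral//; exact: measurable_funTS.
Qed.

End density.

(** * Moments of [mu] as integrals of its tail *)

Section tail_moment.
Context (R : realType).
Local Notation leb := (@lebesgue_measure R).

(** Differentiability gives continuity at positive points only; the endpoint 0 needs the right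
    limit, which is 0 because [l > 0]. *)
Lemma within_continuous_powR (l x : R) : 0 < l -> 0 < x ->
  {within `[0, x], continuous (fun z : R => z `^ l)}.
Proof.
move=> l0 x0.
have cpos (z : R) : 0 < z -> {for z, continuous (fun z : R => z `^ l)}.
  move=> z0; apply/differentiable_continuous/derivable1_diffP.
  by apply: derivable_powR; rewrite in_itv/= z0.
apply/continuous_within_itvP => //; split.
- by move=> z; rewrite in_itv/= => /andP[z0 _]; exact: cpos.
- by rewrite powR0 ?gt_eqF//; exact: powR_cvg0.
- by apply: cvg_at_left_filter; exact: cpos.
Qed.

Lemma integral_powR (l x : R) : 0 < l -> 0 <= x ->
  (\int[leb]_(z in `[0%R, x]%classic) ((l + 1) * z `^ l)%:E = (x `^ (l + 1))%:E)%E.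
Proof.
move=> l0; rewrite le_eqVlt => /predU1P[<-|x0].
  by rewrite set_itv1 integral_set1 powR0// gt_eqF// addr_gt0.
have l10 : 0 < l + 1 by rewrite addr_gt0.
have := within_continuous_powR l10 x0 => /(continuous_within_itvP _ x0)[cF F0 Fx].
rewrite (@continuous_FTC2 _ _ (fun z => z `^ (l + 1)))//.
- by rewrite powR0 ?gt_eqF// sube0.
- by move=> z; apply: cvgM; [exact: cvg_cst|exact: within_continuous_powR].
- split => // z; rewrite in_itv/= => /andP[z0 _].
  by apply: derivable_powR; rewrite in_itv/= z0.
- move=> z; rewrite in_itv/= => /andP[z0 _].
  by rewrite powR_derive1 ?in_itv/= ?z0// addrK.
Qed.

(* Fubini on {(x, z) : 0 <= z <= x}, using x^(l+1) = \int_0^x (l+1) z^l dz. *)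
Lemma tail_moment (mu : probability R R) (l : R) : 0 < l ->
  (\int[mu]_(x in `[0%R, +oo[%classic) (x `^ (l + 1))%:E =
   (l + 1)%:E *
     \int[leb]_(z in `[0%R, +oo[%classic) (G_mu mu z * z `^ l)%:E)%E.
Proof.
move=> l0.
have l10 : 0 < l + 1 by rewrite addr_gt0.
(* With the factor [l + 1] inside the kernel, integrating out [z] gives exactly [x^(l+1)] for
   [x >= 0], and 0 for [x < 0]. *)
pose k (w : R * measurableTypeR R) : \bar R :=
  ((\1_[set w : R * measurableTypeR R | (0 <= w.2 <= w.1)%R] w) *
   ((l + 1) * w.2 `^ l))%:E.
have k0 w : (0 <= k w)%E.
  by rewrite lee_fin mulr_ge0// mulr_ge0 ?powR_ge0// ltW.
have mk : measurable_fun setT k.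
  apply/measurable_EFinP; apply: measurable_funM.
    apply: measurable_indic.
    rewrite (_ : [set w | _] =
      (fun w : R * measurableTypeR R => (0 <= w.2 <= w.1)%R) @^-1` [set true]).
      rewrite -[X in measurable X]setTI.
      suff : measurable_fun setT
        (fun w : R * measurableTypeR R => (0 <= w.2 <= w.1)%R) by apply.
      by apply: measurable_and; exact: measurable_fun_ler.
    by apply/seteqP; split.
  apply: measurable_funM => //.
  by apply: (measurableT_comp (measurable_powR l)).
transitivity (\int[mu]_x \int[leb]_z k (x, z))%E.
  rewrite integral_mkcond; apply: eq_integral => x _; rewrite patchE.
  case: ifPn; rewrite ?inE ?notin_setE/= in_itv/= andbT.
  - move=> x0; rewrite -integral_powR// [LHS]integral_mkcond.
    apply: eq_integral => z _; rewrite patchE /k indicE/=.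
    case: ifPn; rewrite ?inE ?notin_setE/= in_itv/= => zx.
      by rewrite mem_set//= mul1r.
    by rewrite memNset//= mul0r.
  - move=> x0; apply/esym/integral0_eq => z _; rewrite /k indicE memNset ?mul0r//=.
    by move=> /andP[z0 zx]; apply: x0; exact: le_trans z0 zx.
rewrite fubini_tonelli// -ge0_integralZl//; last 3 first.
- apply/measurable_EFinP/measurable_funM; last exact/measurable_funTS.
  by apply: nonincreasing_measurable => // a b; exact: G_mu_nonincreasing.
- by move=> z _; rewrite lee_fin mulr_ge0 ?powR_ge0 ?G_mu_ge0.
- by rewrite lee_fin ltW.
rewrite [RHS]integral_mkcond; apply: eq_integral => z _; rewrite patchE.
case: ifPn; rewrite ?inE ?notin_setE/= in_itv/= andbT => z0; last first.
  apply: integral0_eq => x _; rewrite /k indicE memNset ?mul0r//=.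
  by move=> /andP[/z0].
(* For [z >= 0] the section in [x] is [[z, oo)], whose [mu]-mass is [G_mu mu z]. *)
under eq_integral => x _.
  rewrite (_ : k (x, z) = ((l + 1) * z `^ l)%:E * (\1_`[z, +oo[ x)%:E)%E; last first.
    rewrite /k -EFinM mulrC; congr (_ * _)%:E; rewrite !indicE; congr ((nat_of_bool _)%:R).
    by apply/idP/idP; rewrite !inE/= in_itv/= z0 andbT.
  over.
rewrite ge0_integralZl//; last 2 first.
- exact/measurable_EFinP/measurable_indic.
- by rewrite lee_fin mulr_ge0 ?powR_ge0// ltW.
rewrite integral_indic// setIT.
transitivity (((l + 1) * z `^ l)%:E * (G_mu mu z)%:E)%E; first by rewrite G_muE.
by rewrite -!EFinM -mulrA (mulrC (z `^ l)).
Qed.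

End tail_moment.

(** At [x = 0] the conventions agree: [lne 0] is [-oo], [l > 0] keeps it so, and its exponential 0
    equals [0^l]. *)
Lemma expeR_scale_lne (R : realType) (l x : R) : 0 < l -> 0 <= x ->
  (expeR (l%:E * lne x%:E) = (x `^ l)%:E)%E.
Proof.
move=> l0; rewrite le_eqVlt => /predU1P[<-|x0].
  by rewrite le0_lneNy// gt0_muleNy ?lte_fin// powR0// gt_eqF.
by rewrite lne_EFin//= /powR gt_eqF.
Qed.

(** * Transfer of integrals to the law [mu] *)

Section law.
Context (R : realType) (mu : probability R R) (d : measure_display)
  (T : measurableType d) (P : probability T R) (g : T -> R).
Hypothesis mu_ge0 : mu `[0%R, +oo[%classic = 1%E.
Hypothesis mg : measurable_fun setT g.
Hypothesis g0 : forall x, 0 <= g x.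
Hypothesis g_law : forall B : set R, measurable B -> P (g @^-1` B) = mu B.

(** Restricting to [[0, oo)] admits functions that are negative elsewhere, such as the identity used
    for the mean. *)
Lemma ge0_integral_law (f : R -> \bar R) : measurable_fun setT f ->
  (forall x, (0 <= x)%R -> 0 <= f x)%E ->
  (\int[P]_x f (g x) = \int[mu]_(x in `[0%R, +oo[%classic) f x)%E.
Proof.
move=> mf f0.
pose gm := HB.pack_for {mfun T >-> R} g (isMeasurableFun.Build _ _ _ _ g mg).
transitivity (\int[pushforward P gm]_(x in `[0%R, +oo[%classic) f x)%E; last first.
  by apply: eq_measure_integral => A mA _; exact: g_law.
rewrite ge0_integral_pushforward//.
- congr integral; apply/seteqP; split => x //= _.
  by rewrite in_itv/= andbT g0.
- exact: measurable_funTS.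
- by move=> y; rewrite inE/= in_itv/= andbT => /f0.
Qed.

Lemma integral_nonneg_support (f : R -> \bar R) : measurable_fun setT f ->
  (\int[mu]_(x in `[0%R, +oo[%classic) f x = \int[mu]_x f x)%E.
Proof.
move=> mf; rewrite integral_mkcond; apply: ae_eq_integral => //.
  by apply/(measurable_restrictT _ _).1 => //; exact: measurable_funTS.
have muC : mu (~` `[0%R, +oo[%classic) = 0%E.
  by rewrite probability_setC// mu_ge0 subee.
exists (~` `[0%R, +oo[%classic); split => //; first exact: measurableC.
by move=> x /= nx xD; apply: nx => _; rewrite patchE mem_set.
Qed.

End law.

Unset Implicit Arguments.

Theorem mainTheorem5 (R : realType) (mu : probability R R)
  (d : measure_display) (T : measurableType d)
  (P : probability T R) (nu : {measure set T -> \bar R}) (p : T -> R) :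
  (* mu is a probability measure on [0,oo) with mean 1 *)
  mu `[0%R, +oo[%classic = 1%E ->
  (\int[mu]_x x%:E)%E = 1%E ->
  (* Lambda_mu finite on a neighbourhood of 0 *)
  (exists eps : R, 0 < eps /\
     forall l : R, 0 <= l < eps -> Lambda_mu mu l \is a fin_num) ->
  (* nu sigma-finite, dP = p dnu *)
  sigma_finite setT nu ->
  measurable_fun setT p -> (forall x, 0 <= p x) ->
  (forall A, measurable A -> P A = (\int[nu]_(x in A) (p x)%:E)%E) ->
  (* range(G_mu) subset range(psi) U {1} *)
  (forall r : R, 0 <= r ->
     G_mu mu r = 1 \/ exists y : R, 0 <= y /\ psi_P P p y = G_mu mu r) ->
  exists Q : probability T R,
    (forall A, measurable A ->
       Q A = (\int[P]_(x in A) (phi_fun mu P p (p x))%:E)%E) /\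
    (forall B : set R, measurable B ->
       P ((fun x => phi_fun mu P p (p x)) @^-1` B) = mu B) /\
    in_U mu P Q.
Proof.
move=> mu_ge0 mean1 _ _ mp _ _ range_G.
pose g x := phi_fun mu P p (p x).
have mg : measurable_fun setT g by exact: measurable_phi_fun_comp.
have g0 x : 0 <= g x by exact: phi_fun_ge0.
have g_law B : measurable B -> P (g @^-1` B) = mu B.
  exact: distribution_phi_fun.
(* The mean of [mu] is the total mass of the future [Q]. *)
have g1 : (\int[P]_x (g x)%:E)%E = 1%E.
  rewrite (ge0_integral_law mg g0 g_law (f := EFin))//.
  by rewrite integral_nonneg_support.
have [Q [QP_density QP]] := exists_probability_density mg g0 g1.
exists Q; split; first by case: QP_density => _ [].
split => //; split => //; exists g; split => // l l0.
rewrite /Lambda_Q /Lambda_mu -tail_moment//.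
under eq_integral => x _ do rewrite expeR_scale_lne//.
rewrite (ge0_integral_is_density QP_density QP)//.
- rewrite -(ge0_integral_law mg g0 g_law (f := fun x => (x `^ (l + 1))%:E)).
  + rewrite (eq_integral (fun x => (g x `^ (l + 1))%:E))// => x _.
    (* [g x] may be 0; splitting the power remains valid because the total exponent [l + 1] is
       nonzero. *)
    by rewrite powRD ?powRr1// gt_eqF// addr_gt0.
  + by apply/measurable_EFinP; exact: measurable_powR.
  + by move=> x x0; rewrite lee_fin powR_ge0.
- apply/measurable_EFinP.
  by apply: (measurableT_comp (measurable_powR l)).
- by move=> x; rewrite lee_fin powR_ge0.
Qed.
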